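(* Let $\mathcal{X} := (X, =_X, \neq_X, <_X)$ and $\mathcal{Y} := (Y, =_Y, \neq_Y, <_Y)$ be $\exists$-well-founded sets, and on $X \times Y$ let $$(x, y) <_{\mathrm{lex}} (x', y') :\Leftrightarrow x <_X x' \vee (x =_X x' \ \&\ y <_Y y').$$ Then, constructively: (i) $\mathcal{X} \times_{\mathrm{lex}} \mathcal{Y} := (X \times Y, =_{X \times Y}, \neq_{X \times Y}, <_{\mathrm{lex}})$ is an $\exists$-well-founded set. (ii) If $\mathcal{X}$ and $\mathcal{Y}$ are strong, then $\mathcal{X} \times_{\mathrm{lex}} \mathcal{Y}$ is strong. (iii) If $\mathcal{X} \times_{\mathrm{lex}} \mathcal{Y}$ is strong and $X, Y$ are inhabited, then $\mathcal{X}$ and $\mathcal{Y}$ are strong. (iv) If $\mathcal{X} \times_{\mathrm{lex}} \mathcal{Y}$ is dichotomous and $X, Y$ are inhabited, then $\mathcal{X}$ and $\mathcal{Y}$ are dichotomous.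
   Context: Setting: Bishop-style constructive mathematics (intuitionistic reasoning). $\bot_{\mathbb{N}} := (0 =_{\mathbb{N}} 1)$. A set with an extensional inequality and relation is a structure $\mathcal{X} = (X, =_X, \neq_X, <_X)$, where $=_X$ is an equivalence relation (the equality of $X$); $\neq_X$ is a binary relation on $X$ such that $x =_X y \ \&\ x \neq_X y \Rightarrow \bot_{\mathbb{N}}$, $x \neq_X y \Rightarrow y \neq_X x$, and $\neq_X$ is extensional ($x =_X x'$, $y =_X y'$ and $x \neq_X y$ imply $x' \neq_X y'$); and $<_X$ is an extensional binary relation on $X$ ($x =_X x'$, $y =_X y'$ and $x <_X y$ imply $x' <_X y'$). No further property of $<_X$ is assumed. $\mathcal{X}$ is strong if $x <_X x' \Rightarrow x \neq_X x'$ for all $x,x' \in X$, and dichotomous if $x \neq_X x' \Rightarrow (x <_X x' \vee x' <_X x)$ for all $x,x' \in X$. A formula $P(x)$ on $X$ is extensional if $x =_X y$ and $P(x)$ imply $P(y)$. A set with an extensional inequality and relation $\mathcal{X}$ is an $\exists$-well-founded set if for all extensional formulas $Q(x), P(x)$ on $X$ with $$\forall_{x \in X}\Big(Q(x) \Rightarrow \big[P(x) \vee \exists_{x' \in X}(x' <_X x \ \&\ Q(x'))\big]\Big),$$ one has $\exists_{x \in X} Q(x) \Rightarrow \exists_{x \in X} P(x)$. On $X \times Y$, equality $=_{X\times Y}$ is componentwise and $(x, y) \neq_{X \times Y} (x', y') :\Leftrightarrow x \neq_X x' \vee y \neq_Y y'$. *)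

(* Defs.v *)
From Stdlib Require Export RelationClasses Relation_Definitions.

(* Falsum of Bishop-style mathematics, [0 = 1] in the natural numbers. *)
Definition botN : Prop := 0 = 1.

(* Only the data (X, =_X, <>_X, <_X); the laws are in [ExtIneqRelSet], so that
   "the lexicographic product is such a set" is a statement to be proved and
   not part of the construction of the product. *)
Record IneqRelStructure : Type := MkIneqRelStructure {
  carrier :> Type;
  eqS : relation carrier;
  neqS : relation carrier;
  ltS : relation carrier
}.

Arguments eqS {_} _ _.
Arguments neqS {_} _ _.
Arguments ltS {_} _ _.

Declare Scope ineqrel_scope.
Delimit Scope ineqrel_scope with ineqrel.
Notation "x == y" := (eqS x y) (at level 70, no associativity) : ineqrel_scope.
Notation "x # y" := (neqS x y) (at level 70, no associativity) : ineqrel_scope.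
Notation "x << y" := (ltS x y) (at level 70, no associativity) : ineqrel_scope.
Local Open Scope ineqrel_scope.

Definition extensional_rel (X : IneqRelStructure) (R : relation X) : Prop :=
  forall x x' y y' : X, x == x' -> y == y' -> R x y -> R x' y'.

Definition extensional_pred (X : IneqRelStructure) (P : X -> Prop) : Prop :=
  forall x y : X, x == y -> P x -> P y.

Record ExtIneqRelSet (X : IneqRelStructure) : Prop := {
  eqS_equiv : Equivalence (@eqS X);
  neqS_eqS_bot : forall x y : X, x == y /\ x # y -> botN;
  neqS_sym : forall x y : X, x # y -> y # x;
  neqS_ext : extensional_rel X (@neqS X);
  ltS_ext : extensional_rel X (@ltS X)
}.

Definition strong (X : IneqRelStructure) : Prop :=
  forall x x' : X, x << x' -> x # x'.

Definition dichotomous (X : IneqRelStructure) : Prop :=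
  forall x x' : X, x # x' -> x << x' \/ x' << x.

(* "Formulas on X" are arbitrary predicates [X -> Prop]. *)
Definition ex_descent_property (X : IneqRelStructure) : Prop :=
  forall Q P : X -> Prop,
    extensional_pred X Q -> extensional_pred X P ->
    (forall x : X, Q x -> P x \/ exists x' : X, x' << x /\ Q x') ->
    (exists x : X, Q x) -> exists x : X, P x.

Definition ex_well_founded_set (X : IneqRelStructure) : Prop :=
  ExtIneqRelSet X /\ ex_descent_property X.

Definition prod_eq (X Y : IneqRelStructure) : relation (X * Y) :=
  fun p q => fst p == fst q /\ snd p == snd q.

Definition prod_neq (X Y : IneqRelStructure) : relation (X * Y) :=
  fun p q => fst p # fst q \/ snd p # snd q.

Definition lex_lt (X Y : IneqRelStructure) : relation (X * Y) :=
  fun p q => fst p << fst q \/ (fst p == fst q /\ snd p << snd q).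

Definition lex_prod (X Y : IneqRelStructure) : IneqRelStructure :=
  MkIneqRelStructure (X * Y) (prod_eq X Y) (prod_neq X Y) (lex_lt X Y).

(* Main.v *)
Require Import Defs.

Local Open Scope ineqrel_scope.

(** The only substantial point is that descent passes to the lexicographic
    product, and it does so by nesting the two descents.  Let [Q] and [P] be as
    in the descent property on the product.  Over a fixed first coordinate [x],
    a descending step from [(x, y)] either lowers [y] inside the fibre over [x]
    or leaves the fibre downwards.  Descent on [Y], with leaving the fibre
    counted as success, therefore yields a point of [P] over [x] or a point of
    [Q] over some [x' << x].  This dichotomy is exactly what descent on [X]
    requires of the projections of [Q] and [P] to [X]; see [lex_prod_descent].

    Strength and dichotomy pass from the product to its factors by placing two
    elements of one factor over a common point of the other.  The unwanted
    disjunct then asserts [z # z] or [z << z] for that point [z].  The former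
    contradicts the disjointness of [#] and [==].  The latter is excluded
    because descent on a factor makes its relation irreflexive ([ltS_irrefl]):
    a loop [z << z] would be an endless descent. *)

Lemma neqS_irrefl (X : IneqRelStructure) (hX : ExtIneqRelSet X) (x : X) :
  x # x -> False.
Proof.
  intro n. pose proof (eqS_equiv X hX) as EX.
  assert (bot : botN).
  { apply (neqS_eqS_bot X hX x x). split; [reflexivity | exact n]. }
  discriminate bot.
Qed.

(** If [x << x], the equality class of [x] descends into itself for ever, so
    descent from it reaches the empty predicate. *)
Lemma ltS_irrefl (X : IneqRelStructure) (hX : ex_well_founded_set X) (x : X) :
  x << x -> False.
Proof.
  destruct hX as [sX dX]. intro l.
  pose proof (eqS_equiv X sX) as EX.
  destruct (dX (fun z => z == x) (fun _ => False)) as [z []].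
  - intros a b eab ea. transitivity a; [symmetry; exact eab | exact ea].
  - intros a b _ [].
  - intros z ez. right. exists x. split; [| reflexivity].
    apply (ltS_ext X sX x x x z); [reflexivity | symmetry; exact ez | exact l].
  - exists x. reflexivity.
Qed.

Lemma lex_prod_ExtIneqRelSet (X Y : IneqRelStructure)
    (hX : ExtIneqRelSet X) (hY : ExtIneqRelSet Y) :
  ExtIneqRelSet (lex_prod X Y).
Proof.
  pose proof (eqS_equiv X hX) as EX. pose proof (eqS_equiv Y hY) as EY.
  split.
  - split.
    + intros [x y]. split; reflexivity.
    + intros [x y] [x' y'] [ex ey]. split; symmetry; assumption.
    + intros [x y] [x' y'] [x'' y''] [ex ey] [ex' ey']. cbn in *.
      split; [transitivity x' | transitivity y']; assumption.
  - intros [x y] [x' y'] [[ex ey] [n | n]].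
    + exact (neqS_eqS_bot X hX x x' (conj ex n)).
    + exact (neqS_eqS_bot Y hY y y' (conj ey n)).
  - intros [x y] [x' y'] [n | n]; [left | right].
    + exact (neqS_sym X hX x x' n).
    + exact (neqS_sym Y hY y y' n).
  - intros [x1 y1] [x2 y2] [x3 y3] [x4 y4] [ex ey] [ex' ey'] [n | n];
      [left | right].
    + exact (neqS_ext X hX x1 x2 x3 x4 ex ex' n).
    + exact (neqS_ext Y hY y1 y2 y3 y4 ey ey' n).
  - intros [x1 y1] [x2 y2] [x3 y3] [x4 y4] [ex ey] [ex' ey'] [l | [e l]];
      cbn in *; [left | right; split]; cbn.
    + exact (ltS_ext X hX x1 x2 x3 x4 ex ex' l).
    + transitivity x1; [symmetry; exact ex |].
      transitivity x3; assumption.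
    + exact (ltS_ext Y hY y1 y2 y3 y4 ey ey' l).
Qed.

(** Descent on [Y] inside each fibre provides the step for descent on [X]. *)
Lemma lex_prod_descent (X Y : IneqRelStructure)
    (hX : ex_well_founded_set X) (hY : ex_well_founded_set Y) :
  ex_descent_property (lex_prod X Y).
Proof.
  destruct hX as [sX dX]. destruct hY as [sY dY].
  pose proof (eqS_equiv X sX) as EX. pose proof (eqS_equiv Y sY) as EY.
  intros Q P extQ extP step [[x0 y0] q0].
  destruct (dX (fun x => exists y : Y, Q (x, y))
               (fun x => exists y : Y, P (x, y))) as [x [y p]].
  - intros a b e [y q]. exists y.
    apply (extQ (a, y)); [split; [exact e | reflexivity] | exact q].
  - intros a b e [y p]. exists y.
    apply (extP (a, y)); [split; [exact e | reflexivity] | exact p].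
  - intros x [y q].
    (* The second disjunct of the target does not mention the fibre
       coordinate: it is the event that the descent has left the fibre. *)
    destruct (dY (fun v => Q (x, v))
                 (fun v => P (x, v) \/
                    exists x' : X, x' << x /\ exists y' : Y, Q (x', y')))
      as [v [p | below]].
    + intros a b e. apply extQ. split; [reflexivity | exact e].
    + intros a b e [p | below]; [left | right; exact below].
      apply (extP (x, a)); [split; [reflexivity | exact e] | exact p].
    + intros v qv.
      destruct (step (x, v) qv) as [p | [[x' y'] [[l | [e l]] q']]];
        cbn in *.
      * left. left. exact p.
      * left. right. exists x'. split; [exact l | exists y'; exact q'].
      * (* The new point lies over [x'], which is only equal to [x] in the
           sense of [==]; extensionality of [Q] moves it to the fibre of [x]. *)
        right. exists y'. split; [exact l |].
        apply (extQ (x', y')); [split; [exact e | reflexivity] | exact q'].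
    + exists y. exact q.
    + left. exists v. exact p.
    + right. exact below.
  - exists x0, y0. exact q0.
  - exists (x, y). exact p.
Qed.

Lemma lex_prod_strong (X Y : IneqRelStructure) :
  strong X -> strong Y -> strong (lex_prod X Y).
Proof.
  intros tX tY [x y] [x' y'] [l | [_ l]]; [left | right].
  - exact (tX x x' l).
  - exact (tY y y' l).
Qed.

Lemma strong_lex_prod_factors (X Y : IneqRelStructure)
    (hX : ExtIneqRelSet X) (hY : ExtIneqRelSet Y) :
  strong (lex_prod X Y) -> inhabited X -> inhabited Y -> strong X /\ strong Y.
Proof.
  pose proof (eqS_equiv X hX) as EX.
  intros t [x0] [y0]. split.
  - intros x x' l.
    destruct (t (x, y0) (x', y0)) as [n | n]; [left; exact l | exact n |].
    destruct (neqS_irrefl Y hY y0 n).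
  - intros y y' l.
    destruct (t (x0, y) (x0, y')) as [n | n]; [| | exact n].
    + right. split; [reflexivity | exact l].
    + destruct (neqS_irrefl X hX x0 n).
Qed.

Lemma dichotomous_lex_prod_factors (X Y : IneqRelStructure)
    (hX : ex_well_founded_set X) (hY : ex_well_founded_set Y) :
  dichotomous (lex_prod X Y) -> inhabited X -> inhabited Y ->
  dichotomous X /\ dichotomous Y.
Proof.
  intros d [x0] [y0]. split.
  - intros x x' n.
    destruct (d (x, y0) (x', y0) (or_introl n)) as [[l | [_ l]] | [l | [_ l]]].
    + left. exact l.
    + destruct (ltS_irrefl Y hY y0 l).
    + right. exact l.
    + destruct (ltS_irrefl Y hY y0 l).
  - intros y y' n.
    destruct (d (x0, y) (x0, y') (or_intror n)) as [[l | [_ l]] | [l | [_ l]]].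
    + destruct (ltS_irrefl X hX x0 l).
    + left. exact l.
    + destruct (ltS_irrefl X hX x0 l).
    + right. exact l.
Qed.

Theorem proposition6p5 (X Y : IneqRelStructure)
    (hX : ex_well_founded_set X) (hY : ex_well_founded_set Y) :
  ex_well_founded_set (lex_prod X Y)
  /\ (strong X -> strong Y -> strong (lex_prod X Y))
  /\ (strong (lex_prod X Y) -> inhabited X -> inhabited Y ->
        strong X /\ strong Y)
  /\ (dichotomous (lex_prod X Y) -> inhabited X -> inhabited Y ->
        dichotomous X /\ dichotomous Y).
Proof.
  split; [| split; [| split]].
  - split.
    + exact (lex_prod_ExtIneqRelSet X Y (proj1 hX) (proj1 hY)).
    + exact (lex_prod_descent X Y hX hY).
  - exact (lex_prod_strong X Y).
  - exact (strong_lex_prod_factors X Y (proj1 hX) (proj1 hY)).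
  - exact (dichotomous_lex_prod_factors X Y hX hY).
Qed.
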